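(* For any odd integer $q\ge 1$ and any positive integers $M,N\le q$, we have $$\sum_{c=1}^q \Delta(M,N;q,c)^2 \le (M+N)^2\, q^{o(1)}.$$
   Context: For positive integers $M,N,q$ and an arbitrary integer $c$, let $$A(M,N;q,c)=\#\{(m,n)\in\mathbb{Z}^2 : 1\le m\le M,\ 1\le n\le N,\ m^2-n^2\equiv c \pmod q\},$$ let $A_0(q,c)=A(q,q;q,c)$, and let $$\Delta(M,N;q,c)=\left|A(M,N;q,c)-\frac{MN}{q^2}A_0(q,c)\right|.$$ The factor $q^{o(1)}$ is understood in the usual sense, uniformly in $M$ and $N$: for every $\varepsilon>0$ there is a constant $C(\varepsilon)>0$, depending only on $\varepsilon$, such that the left-hand side is at most $C(\varepsilon)(M+N)^2q^{\varepsilon}$ for all odd $q\ge 1$ and all positive integers $M,N\le q$. *)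

(* Defs.v *)
From mathcomp Require Import all_boot all_order all_algebra.
From mathcomp Require Import reals exp.

Set Implicit Arguments.
Unset Strict Implicit.
Unset Printing Implicit Defensive.

Import Order.TTheory GRing.Theory Num.Theory.
Local Open Scope ring_scope.

(* ['I_M.+1] is {0, ..., M}; the positivity tests cut it down to {1, ..., M}.
   Squares are subtracted in [int], since subtraction on [nat] is truncated. *)
Definition A (M N q : nat) (c : int) : nat :=
  #|[set p : 'I_M.+1 * 'I_N.+1 |
      [&& (0 < p.1)%N, (0 < p.2)%N
        & ((p.1%:Z ^+ 2 - p.2%:Z ^+ 2)%R == c %[mod q%:Z])%Z]]|.

Definition A0 (q : nat) (c : int) : nat := A q q q c.

Definition Delta (R : realType) (M N q : nat) (c : int) : R :=
  `| (A M N q c)%:R - (M%:R * N%:R) / q%:R ^+ 2 * (A0 q c)%:R |.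

(* Main.v *)
Require Import Defs.
From mathcomp Require Import all_boot all_order all_algebra.
From mathcomp Require Import reals exp.
From mathcomp Require Import trigo complex zify ring lra.
Import Order.TTheory GRing.Theory Num.Theory.

(** Let [e_q(z) = exp (2 i pi z / q)], let [S_M(a)] be the sum of [e_q(a m^2)] over
    [1 <= m <= M], and let [G(a) = S_q(a)]. The Fourier transform in [c] of
    [A(M, N; q, c)] is [S_M(a)] times the conjugate of [S_N(a)], so by Parseval the
    sum of the squares of the discrepancies is [1 / q] times the sum over [a] of
    the squared moduli of [S_M(a) S_N(a)^* - (M N / q^2) |G(a)|^2].

    Write [a / q = b / q'] in lowest terms. Modulo [q'] the range of [m] consists of
    complete blocks and one incomplete block of length [M' = M mod q'], whence
    [S_M(a) = (M / q') G'(b) + s_M(b)], where [G'(b)] is the complete Gauss sum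
    modulo [q'] and [s_M(b) = S_{M'}(b) - (M' / q') G'(b)] ([gauss_split]). The main
    terms cancel against [(M N / q^2) |G(a)|^2], and since [|G'(b)|^2 = q'] the
    remaining terms are controlled by the fourth moments of [s_M] and [s_N] over
    the [b] coprime to [q'] ([sqnorm_discr_hat_le]). What is needed is therefore

      the sum over [b] coprime to [q] of [|S_M(b)|^4] is at most [M^2 q^(1 + o(1))]

    for [M <= q]. By Weyl differencing ([weyl_ineq]), [|S_M(b)|^2] is at most [M]
    plus twice the sum over [0 < x < M] of [min(M, q / ||2 b x||)], where [||z||]
    is the distance from [z] to the multiples of [q]. After a dyadic decomposition
    the square of this sum counts pairs [x, x'] such that [2 b x] and [2 b x'] have
    small residues [u] and [v] modulo [q]; then [x v = x' u + k q] for some small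
    [k]. Given [x'], [u] and [k], the number of possible [x] is at most the number
    of divisors of a nonzero integer, and [x] and [u] then essentially determine
    [b] ([count_triples]). The integer [x v] is nonzero because [b] is coprime to
    [q] and [0 < x' < q]: this is where passing to lowest terms pays off.

    All losses are powers of the maximal number [D] of divisors of an integer up to
    [q^2], and [D = q^o(1)] ([size_divisors_exp]). *)

Set Implicit Arguments.
Unset Strict Implicit.
Unset Printing Implicit Defensive.

(** * The divisor function *)

(** A divisor of [p ^ a * m] is a power [p ^ i], with [i <= a], times a divisor
    of [m]. *)
Lemma size_divisors_pfactor p a m : prime p -> coprime p m -> 0 < m ->
  size (divisors (p ^ a * m)) <= a.+1 * size (divisors m).
Proof.
move=> p_pr cpm m_gt0.
have p_gt0 := prime_gt0 p_pr.
have n_gt0 : 0 < p ^ a * m by rewrite muln_gt0 expn_gt0 p_gt0.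
have -> : a.+1 * size (divisors m)
    = size [seq p ^ i * d | i <- iota 0 a.+1, d <- divisors m].
  by rewrite size_allpairs size_iota.
apply: uniq_leq_size (divisors_uniq _) _ => d; rewrite -dvdn_divisors // => dv.
have d_gt0 := dvdn_gt0 n_gt0 dv.
apply/allpairsP; exists (logn p d, d`_p^'); split.
- change (logn p d \in iota 0 a.+1); rewrite mem_iota add0n ltnS.
  have := dvdn_leq_log p n_gt0 dv.
  rewrite lognM ?expn_gt0 ?p_gt0 // pfactorK //.
  by rewrite (logn_coprime cpm) addn0.
- rewrite /= -dvdn_divisors // -(@Gauss_dvdr _ (p ^ a)).
    exact: dvdn_trans (dvdn_part _ _) dv.
  apply: (@p'nat_coprime p); first exact: part_pnat.
  by rewrite pnatX pnat_id.
- by rewrite /= -p_part partnC.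
Qed.

(** With [t = x %/ k], [x <= k * (t + 1) <= k * 2 ^ t]. *)
Lemma expn_le_exp2 k x : 0 < k -> x ^ k <= k ^ k * 2 ^ x.
Proof.
move=> k_gt0; set t := x %/ k.
have xk : x <= k * 2 ^ t.
  apply: (@leq_trans (k * t.+1)); last by rewrite leq_mul2l ltn_expl // orbT.
  by rewrite mulnC ltnW // ltn_ceil.
apply: (@leq_trans ((k * 2 ^ t) ^ k)); first by rewrite leq_exp2r.
by rewrite expnMn -expnM leq_mul2l leq_pexp2l ?leq_trunc_div ?orbT.
Qed.

(** Peel off the prime powers [p ^ a] one at a time. A prime [p >= 2 ^ k] costs
    nothing, since [(a + 1) ^ k <= 2 ^ (a * k) <= p ^ a]; the exponent counts the
    few smaller primes, each of which costs at most [2 * k ^ k]. *)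
Lemma size_divisors_exp_small k n : 0 < k -> 0 < n ->
  size (divisors n) ^ k
    <= (2 * k ^ k) ^ count (fun p => p < 2 ^ k) (primes n) * n.
Proof.
move=> k_gt0; elim/ltn_ind: n => n IHn n_gt0.
have [n_gt1|] := ltnP 1 n; last first.
  by case: n n_gt0 {IHn} => [|[|]] // _ _; rewrite exp1n muln1 expn_gt0 muln_gt0 expn_gt0 k_gt0.
set p := pdiv n; have p_pr : prime p := pdiv_prime n_gt1.
have p_gt0 := prime_gt0 p_pr.
set m := n`_p^'; set a := logn p n.
have def_n : n = p ^ a * m by rewrite -p_part partnC.
have m_gt0 : 0 < m by rewrite part_gt0.
have cpm : coprime p m.
  by apply: (@pnat_coprime p); rewrite ?pnat_id ?part_pnat.
have a_gt0 : 0 < a by rewrite logn_gt0 mem_primes p_pr n_gt0 pdiv_dvd.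
have lt_mn : m < n.
  rewrite [X in _ < X]def_n -{1}[m]mul1n ltn_mul2r m_gt0 /=.
  by rewrite -(exp1n a) ltn_exp2r // prime_gt1.
have small_le : (p < 2 ^ k) + count (fun p => p < 2 ^ k) (primes m)
    <= count (fun p => p < 2 ^ k) (primes n).
  rewrite -[_ + _]/(count _ (p :: primes m)) -!size_filter.
  apply: uniq_leq_size.
    by rewrite filter_uniq //= primes_uniq andbT mem_primes p_pr m_gt0 -prime_coprime // cpm.
  move=> r; rewrite !mem_filter => /andP[-> /=].
  rewrite inE => /predU1P[->|]; first by rewrite mem_primes p_pr n_gt0 pdiv_dvd.
  by rewrite !mem_primes n_gt0 => /and3P[-> _ /dvdn_trans->]; rewrite ?dvdn_part.
have factor : a.+1 ^ k <= (2 * k ^ k) ^ (p < 2 ^ k) * p ^ a.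
  case: ltnP => [_|le_p]; rewrite ?expn1 ?expn0 ?mul1n.
    apply: leq_trans (expn_le_exp2 _ k_gt0) _.
    rewrite expnS mulnCA mulnA leq_mul2l leq_exp2r // prime_gt1 ?orbT //.
  apply: (@leq_trans ((2 ^ k) ^ a)); last by rewrite leq_exp2r.
  by rewrite -expnM mulnC expnM leq_exp2r // ltn_expl.
rewrite [X in divisors X]def_n; apply: (@leq_trans ((a.+1 * size (divisors m)) ^ k)).
  by rewrite leq_exp2r // size_divisors_pfactor.
rewrite expnMn; apply: leq_trans (leq_mul factor (IHn m lt_mn m_gt0)) _.
rewrite mulnACA -expnD -def_n leq_mul2r leq_pexp2l ?orbT //.
by rewrite muln_gt0 expn_gt0 k_gt0.
Qed.

(** The classical bound [tau n = n ^ o(1)], in integer form: there are at most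
    [2 ^ k] primes below [2 ^ k], so the constant does not depend on [n]. *)
Lemma size_divisors_exp k : 0 < k ->
  exists2 K, 0 < K & forall n, 0 < n -> size (divisors n) ^ k <= K * n.
Proof.
move=> k_gt0; have K_gt0 : 0 < 2 * k ^ k by rewrite muln_gt0 expn_gt0 k_gt0.
exists ((2 * k ^ k) ^ (2 ^ k)) => [|n n_gt0]; first by rewrite expn_gt0 K_gt0.
apply: leq_trans (size_divisors_exp_small k_gt0 n_gt0) _.
rewrite leq_mul2r leq_pexp2l ?orbT // -size_filter -{2}(size_iota 0 (2 ^ k)).
apply: uniq_leq_size; first by rewrite filter_uniq ?primes_uniq.
by move=> r; rewrite mem_filter mem_iota => /andP[].
Qed.

(** * Finite sums and fibres *)

Lemma card_le_fibers (T U : finType) (s : {set T}) (f : T -> U) D :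
  (forall y, #|[set t in s | f t == y]| <= D) -> #|s| <= D * #|U|.
Proof.
move=> fib; rewrite -sum1_card (partition_big f predT) //= mulnC -sum_nat_const.
by apply: leq_sum => y _; apply: leq_trans (fib y); rewrite -sum1dep_card.
Qed.

(** Cauchy-Schwarz against the constant function [1]. *)
Lemma sqr_sum_le (I : Type) (r : seq I) (F : I -> nat) :
  (\sum_(i <- r) F i) ^ 2 <= size r * \sum_(i <- r) F i ^ 2.
Proof.
elim: r => [|i r IHr]; first by rewrite !big_nil.
rewrite !big_cons /= sqrnD mulSn mulnDr addnACA addnAC.
set s := \sum_(j <- r) F j in IHr *; set t := \sum_(j <- r) _ in IHr *.
suff : 2 * (F i * s) <= size r * F i ^ 2 + t by lia.
rewrite /s /t big_distrr /= big_distrr /= -sum1_size big_distrl /= -big_split.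
by apply: leq_sum => j _; rewrite mul1n nat_Cauchy.
Qed.

Local Open Scope ring_scope.

(** * Centred residues *)

(** The residue of [z] modulo [q] of least absolute value; its absolute value
    is the distance from [z] to the nearest multiple of [q]. *)
Definition centered (q : nat) (z : int) : int :=
  let r := (z %% q)%Z in if r * 2 <= q%:Z then r else r - q%:Z.

Definition dist q z : nat := `|centered q z|%N.

Lemma dvdz_sub_centered (q : nat) (z : int) : (q %| z - centered q z)%Z.
Proof.
rewrite /centered; case: ifP => _; first by rewrite -eqz_mod_dvd modz_mod.
by rewrite -eqz_mod_dvd -(modzDr (_ - _)) subrK modz_mod.
Qed.

Lemma dist_le_half (q : nat) (z : int) : (0 < q)%N -> (dist q z * 2 <= q)%N.
Proof.
move=> q_gt0; rewrite /dist /centered.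
have r_ge0 : 0 <= (z %% q)%Z by rewrite modz_ge0 // -lt0n.
have r_lt : (z %% q)%Z < q%:Z by rewrite ltz_pmod.
case: ifP; lia.
Qed.

Lemma dist_gt0 (q : nat) (z : int) : ~~ (q %| z)%Z -> (0 < dist q z)%N.
Proof.
move=> nz; rewrite absz_gt0; apply: contra nz => /eqP z0.
by have := dvdz_sub_centered q z; rewrite z0 subr0.
Qed.

Lemma dvdz_double_mul (q b x : nat) : odd q -> coprime b q ->
  (q %| (2 * b * x)%N%:Z)%Z = (q %| x)%N.
Proof.
move=> oq cbq; rewrite dvdzE !absz_nat Gauss_dvdr //.
by rewrite coprimeMr coprimen2 oq coprime_sym.
Qed.

Lemma absz_shift_inj (a b : int) (U : nat) : (absz a <= U)%N -> (absz b <= U)%N ->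
  absz (a + U%:Z) = absz (b + U%:Z) -> a = b.
Proof. lia. Qed.

(** * Counting pairs of close multipliers *)

(** The multipliers [x] with [2 * b * x] within [q / T] of a multiple of [q],
    sorted by [h = gcd(x, q)]. Fixing the gcd is what makes [b] recoverable from
    [x] and [2 * b * x] modulo [q]. *)
Definition close_multiplier (q T h b x : nat) :=
  [&& (0 < x)%N, gcdn x q == h & (dist q (2 * b * x)%N%:Z * T <= q)%N].

(** The residue of [2 * b * x] only determines [b] modulo [q / h], as [2] and
    [x / h] are units there; the quotient of [b] by [q / h] supplies the rest. *)
Lemma eq_of_centered_quotient (q h b1 b2 x : nat) :
  odd q -> gcdn x q = h -> (0 < x)%N ->
  centered q (2 * b1 * x)%N%:Z = centered q (2 * b2 * x)%N%:Z ->
  (b1 %/ (q %/ h) = b2 %/ (q %/ h))%N -> b1 = b2.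
Proof.
move=> oq gxq x_gt0 eq_res eq_quo.
have q_gt0 : (0 < q)%N by case: (q) oq.
have h_gt0 : (0 < h)%N by rewrite -gxq gcdn_gt0 x_gt0.
have hq : (h %| q)%N by rewrite -gxq dvdn_gcdr.
have hx : (h %| x)%N by rewrite -gxq dvdn_gcdl.
set y := (x %/ h)%N; set q1 := (q %/ h)%N in eq_quo *.
have xE : x = (y * h)%N by rewrite divnK.
have qE : q = (q1 * h)%N by rewrite divnK.
have cyq : coprime y q1.
  by rewrite /coprime -(eqn_pmul2r h_gt0) mul1n muln_gcdl -xE -qE gxq.
have /dvdzP [t tE] : (q %| (2 * b1 * x)%N%:Z - (2 * b2 * x)%N%:Z)%Z.
  have := rpredB (dvdz_sub_centered q (2 * b1 * x)%N%:Z) (dvdz_sub_centered q (2 * b2 * x)%N%:Z).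
  by rewrite eq_res opprB addrA subrK.
have dv : (q1 %| (b1%:Z - b2%:Z))%Z.
  have : (q1%:Z %| (2 * y)%N%:Z * (b1%:Z - b2%:Z))%Z.
    apply/dvdzP; exists t; apply: (mulIf (_ : h%:Z != 0)); first by rewrite -lt0n.
    have e := tE; rewrite qE xE !PoszM in e; rewrite -[RHS]mulrA -e !PoszM; ring.
  rewrite Gauss_dvdzr // coprimezE !absz_nat coprime_sym coprimeMl cyq andbT.
  by rewrite coprime2n; move: oq; rewrite qE oddM => /andP[].
have {dv} : b1 = b2 %[mod q1].
  by move: dv; rewrite -eqz_mod_dvd !modz_nat => /eqP[].
by move=> eq_mod; rewrite (divn_eq b1 q1) (divn_eq b2 q1) eq_quo eq_mod.
Qed.

Local Notation triple q M := ('I_q * ('I_M * 'I_M))%type.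

(** The sum of squares counts triples [(b, (x, x'))]. Write [u] and [v] for the
    centred residues of [2 * b * x] and [2 * b * x']. Both [x * v] and [x' * u]
    are congruent to [2 * b * x * x'], so [x * v = x' * u + k * q] with
    [|k| <= 2 * M / T]. Once [x'], [u] and [k] are chosen, [x] divides a known
    nonzero integer of size at most [q ^ 2], which leaves at most [D] choices;
    then [b] is known modulo [q / h], which leaves [h] choices. Altogether there
    are about [(M / h) * (q / T) * (M / T) * D * h] triples. *)
Lemma count_triples (q M T h D : nat) : odd q -> (0 < T <= M)%N -> (M <= q)%N ->
  (h %| q)%N ->
  (forall n, 0 < n <= q ^ 2 -> size (divisors n) <= D)%N ->
  (T ^ 2 * \sum_(b < q | coprime b q) #|[set x : 'I_M | close_multiplier q T h b x]| ^ 2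
    <= 30 * D * q * M ^ 2)%N.
Proof.
move=> oq /andP[T_gt0 leTM] leMq hq tauD.
have q_gt0 : (0 < q)%N by case: (q) oq.
have h_gt0 := dvdn_gt0 q_gt0 hq.
pose P b x := close_multiplier q T h b x.
(* If M < h, no 0 < x < M is a multiple of h. *)
have [lt_Mh | le_hM] := ltnP M h.
  rewrite big1 ?muln0 // => b _; apply/eqP; rewrite expn_eq0 /= andbT cards_eq0.
  apply/eqP/setP=> x; rewrite !inE; apply/negP => /and3P[x_gt0 /eqP gx _].
  have := dvdn_leq x_gt0 (dvdn_gcdl x q); rewrite gx.
  by have := ltn_ord x; lia.
set q1 := (q %/ h)%N; pose U := (q %/ T)%N; pose K := (2 * M %/ T)%N.
pose s := [set t : triple q M |
            [&& coprime t.1 q, P t.1 t.2.1 & P t.1 t.2.2]].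
have -> : (\sum_(b < q | coprime b q) #|[set x : 'I_M | P b x]| ^ 2 = #|s|)%N.
  rewrite -[RHS]sum1dep_card -(pair_big_dep (fun b : 'I_q => coprime b q)
    (fun b (p : 'I_M * 'I_M) => P b p.1 && P b p.2) (fun _ _ => 1%N)) /=.
  apply: eq_bigr => b _; rewrite sum1dep_card -mulnn -cardsX.
  by apply: eq_card => p; rewrite !inE.
pose u (t : triple q M) := centered q (2 * t.1 * t.2.1)%N%:Z.
pose v (t : triple q M) := centered q (2 * t.1 * t.2.2)%N%:Z.
pose k (t : triple q M) :=
  ((t.2.1%:Z * v t - t.2.2%:Z * u t) %/ q)%Z.
(* The shifts by U and K make the signed quantities u and k natural numbers;
   the last component recovers b modulo q from b modulo q / h. *)
pose f (t : triple q M) :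
    'I_(M %/ h).+1 * 'I_(2 * U).+1 * 'I_(2 * K).+1 * 'I_h.-1.+1 :=
  (inord (t.2.2 %/ h)%N, inord (absz (u t + U%:Z)%R),
   inord (absz (k t + K%:Z)%R), inord (t.1 %/ q1)%N).
have sP (t : triple q M) : t \in s ->
  [/\ [/\ coprime t.1 q, (0 < t.2.1)%N, gcdn t.2.1 q = h & (absz (u t) * T <= q)%N],
   [/\ (0 < t.2.2)%N, gcdn t.2.2 q = h & (absz (v t) * T <= q)%N]
   & (t.2.1%:Z * v t = t.2.2%:Z * u t + k t * q%:Z)%R ].
  rewrite inE => /and3P[-> /and3P[x_gt0 /eqP gx ux] /and3P[y_gt0 /eqP gy uy]].
  split=> //; rewrite /k divzK; first by rewrite [RHS]addrC subrK.
  have -> : t.2.1%:Z * v t - t.2.2%:Z * u t =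
     t.2.2%:Z * ((2 * t.1 * t.2.1)%N%:Z - u t) - t.2.1%:Z * ((2 * t.1 * t.2.2)%N%:Z - v t).
    by rewrite !PoszM; ring.
  by rewrite rpredB // dvdz_mull ?dvdz_sub_centered.
have bnd_u (t : triple q M) : t \in s -> (absz (u t) <= U)%N.
  by case/sP=> [[_ _ _ ?] _ _]; rewrite /U leq_divRL.
have bnd_k (t : triple q M) : t \in s -> (absz (k t) <= K)%N.
  case/sP=> [[_ _ _ hu] [_ _ hv] e]; rewrite /K leq_divRL //.
  rewrite -(leq_pmul2l q_gt0).
  have : (absz (k t * q%:Z)%R <= absz (t.2.1%:Z * v t)%R + absz (t.2.2%:Z * u t)%R)%N.
    have -> : (k t * q%:Z = t.2.1%:Z * v t - t.2.2%:Z * u t)%R.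
      by rewrite e addrC addKr.
    by lia.
  rewrite !abszM !absz_nat => le1.
  have h1 : (t.2.1 * absz (v t) * T <= M * q)%N.
    by rewrite -mulnA leq_mul // ltnW.
  have h2 : (t.2.2 * absz (u t) * T <= M * q)%N.
    by rewrite -mulnA leq_mul // ltnW.
  have := leq_mul le1 (leqnn T); lia.
(* All triples of a fibre share x' * u + k * q = x * v, so x divides one fixed
   nonzero integer; and x determines the triple. *)
have fib y : (#|[set t in s | f t == y]| <= D)%N.
  have [->|[t0]] := set_0Vmem [set t in s | f t == y]; first by rewrite cards0.
  rewrite inE => /andP[t0s /eqP ft0].
  have [[_ x0_gt0 _ _] _ _] := sP _ t0s.
  set n := (absz (t0.2.1%:Z * v t0)%R).
  have n_bnd : (0 < n <= q ^ 2)%N.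
    have [[cb _ _ _] [y_gt0 _ hv] _] := sP _ t0s.
    rewrite /n abszM absz_nat muln_gt0 x0_gt0 /= dist_gt0 /=; last first.
      rewrite dvdz_double_mul // gtnNdvd //.
      exact: leq_trans (ltn_ord _) leMq.
    rewrite leq_mul //; first by apply: ltnW; apply: leq_trans (ltn_ord _) leMq.
    by apply: leq_trans hv; rewrite leq_pmulr.
  have same (t : triple q M) : t \in s -> f t = y ->
     [/\ t.2.2 = t0.2.2, u t = u t0, k t = k t0 & (t.1 %/ q1 = t0.1 %/ q1)%N].
    move=> ts; rewrite -ft0 => -[].
    move=> /(congr1 val) e1 /(congr1 val) e2 /(congr1 val) e3 /(congr1 val) e4.
    have div_le (r : triple q M) : (r.2.2 %/ h < (M %/ h).+1)%N.
      by rewrite ltnS leq_div2r // ltnW.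
    have u_le (r : triple q M) : r \in s -> (absz (u r + U%:Z)%R < (2 * U).+1)%N.
      by move/bnd_u; clear; lia.
    have k_le (r : triple q M) : r \in s -> (absz (k r + K%:Z)%R < (2 * K).+1)%N.
      by move/bnd_k; clear; lia.
    have b_lt (r : triple q M) : (r.1 %/ q1 < h.-1.+1)%N.
      rewrite prednK // ltn_divLR ?divn_gt0 ?(dvdn_leq q_gt0) //.
      by rewrite mulnC divnK.
    move: e1 e2 e3 e4; rewrite /= !inordK ?div_le ?u_le ?k_le ?b_lt //.
    have [_ [_ gt _] _] := sP _ ts; have [_ [_ gt0 _] _] := sP _ t0s.
    have ht : (h %| t.2.2)%N by rewrite -gt dvdn_gcdl.
    have ht0 : (h %| t0.2.2)%N by rewrite -gt0 dvdn_gcdl.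
    move=> e1 e2 e3 e4; split=> //.
    + by apply: val_inj; rewrite /= -(divnK ht) e1 divnK.
    + exact: absz_shift_inj (bnd_u _ ts) (bnd_u _ t0s) e2.
    + exact: absz_shift_inj (bnd_k _ ts) (bnd_k _ t0s) e3.
  have n_eq (t : triple q M) : t \in s -> f t = y ->
    (t.2.1%:Z * v t = t0.2.1%:Z * v t0)%R.
    move=> ts fty; have [e1 e2 e3 _] := same t ts fty.
    by have [_ _ ->] := sP _ ts; have [_ _ ->] := sP _ t0s; rewrite e1 e2 e3.
  apply: leq_trans (tauD n n_bnd).
  rewrite cardE -(size_map (fun t : triple q M => val t.2.1)).
  apply: uniq_leq_size.
    rewrite map_inj_in_uniq ?enum_uniq // => t1 t2.
    rewrite !mem_enum => /setIdP[t1s /eqP ft1] /setIdP[t2s /eqP ft2] /= eqx.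
    have [e1 e2 _ e4] := same t1 t1s ft1; have [e1' e2' _ e4'] := same t2 t2s ft2.
    have [[_ x1_gt0 g1 _] _ _] := sP _ t1s.
    have eqb : t1.1 = t2.1.
      apply/val_inj; apply: (eq_of_centered_quotient oq g1 x1_gt0).
        by have := etrans e2 (esym e2'); rewrite /u -eqx.
      by rewrite -/q1 e4 e4'.
    have eqx2 : t1.2.1 = t2.2.1 by exact: val_inj.
    have eqy : t1.2.2 = t2.2.2 by rewrite e1 e1'.
    by case: t1 t2 eqb eqx2 eqy {t1s t2s ft1 ft2 e1 e2 e4 e1' e2' e4' x1_gt0 g1 eqx}
      => [b1 [x1 y1]] [b2 [x2 y2]] /= -> -> ->.
  move=> x /mapP[t]; rewrite mem_enum => /setIdP[ts /eqP fty] ->.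
  rewrite -dvdn_divisors; last by case/andP: n_bnd.
  by rewrite /n -(n_eq t ts fty) abszM absz_nat dvdn_mulr.
have := card_le_fibers fib.
rewrite !card_prod !card_ord prednK // => le_s.
have U_le : ((2 * U).+1 * T <= 3 * q)%N.
  have := leq_trunc_div q T; rewrite -/U; lia.
have K_le : ((2 * K).+1 * T <= 5 * M)%N.
  have := leq_trunc_div (2 * M) T; rewrite -/K; lia.
have h_le : ((M %/ h).+1 * h <= 2 * M)%N.
  have := leq_trunc_div M h; lia.
have := leq_mul (leqnn D) (leq_mul (leq_mul U_le K_le) h_le).
have -> : (D * (3 * q * (5 * M) * (2 * M)) = 30 * D * q * M ^ 2)%N by ring.
move=> h0; apply: leq_trans h0; have := leq_mul (leqnn (T ^ 2)) le_s.
by move/leq_trans; apply; apply: eq_leq; ring.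
Qed.

(** * The second moment of Weyl sums *)

(** Bound for the linear sums that arise when the square of a quadratic
    exponential sum is expanded (Weyl differencing): a geometric sum of at most
    [M] terms and ratio [exp (2 i pi z / q)] has modulus at most the minimum of
    [M] and [q / dist q z]. *)
Definition weyl_sum (q M b : nat) : nat :=
  (\sum_(x < M | (0 < x)%N) minn M (q %/ dist q (2 * b * x)%N%:Z))%N.

(** The powers of two up to [y] add up to at least [y]. *)
Lemma dyadic_le (L y : nat) : (y < 2 ^ L)%N ->
  (y <= \sum_(j < L) 2 ^ j * (2 ^ j <= y))%N.
Proof.
elim: L => [|L IHL] lt_y; first by rewrite big_ord0; lia.
rewrite big_ord_recr /=; case: (leqP (2 ^ L) y) => [le_y|/IHL]; last by rewrite muln0 addn0.
rewrite muln1; have lt_s : (2 ^ L <= 1 + \sum_(j < L) 2 ^ j * (2 ^ j <= y))%N.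
  rewrite (eq_bigr (fun j : 'I_L => 2 ^ j)%N) => [|j _]; last first.
    by rewrite (leq_trans _ le_y) ?muln1 // leq_pexp2l // ltnW.
  by have := predn_exp 2 L; rewrite mul1n => <-; lia.
move: lt_s lt_y {le_y}; rewrite expnS; move: (\sum_(j < L) _)%N (2 ^ L)%N => s t; lia.
Qed.

Lemma size_divisors_exp2 (l : nat) : (l < size (divisors (2 ^ l)))%N.
Proof.
rewrite -(size_iota 0 l.+1) -(size_map (expn 2)).
apply: uniq_leq_size.
  by rewrite map_inj_uniq ?iota_uniq // => i j /eqP; rewrite eqn_exp2l // => /eqP.
move=> d /mapP[j]; rewrite mem_iota add0n => /andP[_ le_j] ->.
by rewrite -dvdn_divisors ?expn_gt0 // dvdn_exp2l.
Qed.

(** Dyadic decomposition of the summands [minn M (q %/ dist q _)], followed by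
    a splitting of [x] according to [gcd(x, q)]. *)
Lemma weyl_sum_le (q M b : nat) : odd q -> coprime b q -> (0 < M <= q)%N ->
  (weyl_sum q M b <= \sum_(j < (trunc_log 2 M).+1)
     2 ^ j * \sum_(h <- divisors q) #|[set x : 'I_M | close_multiplier q (2 ^ j) h b x]|)%N.
Proof.
move=> oq cb /andP[M_gt0 le_Mq]; have q_gt0 : (0 < q)%N by case: (q) oq.
pose N (j : nat) (x : 'I_M) := (dist q (2 * b * x)%N%:Z * 2 ^ j <= q)%N.
apply: (@leq_trans (\sum_(x < M | (0 < x)%N) \sum_(j < (trunc_log 2 M).+1) 2 ^ j * N j x)).
  apply: leq_sum => x x_gt0.
  apply: leq_trans (dyadic_le _) _.
    by apply: leq_ltn_trans (geq_minl _ _) _; apply: trunc_log_ltn.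
  apply: leq_sum => j _; rewrite leq_mul2l leq_min; apply/orP; right.
  case: andP => // -[_]; rewrite leq_divRL /N; first by rewrite mulnC => ->.
  apply: dist_gt0; rewrite dvdz_double_mul // gtnNdvd //.
  exact: leq_trans (ltn_ord _) le_Mq.
rewrite exchange_big /=; apply: leq_sum => j _.
rewrite -big_distrr /= leq_mul2l; apply/orP; right.
apply: (@leq_trans (\sum_(x < M | (0 < x)%N) \sum_(h <- divisors q)
    close_multiplier q (2 ^ j) h b x)).
  apply: leq_sum => x x_gt0; rewrite (big_rem (gcdn x q)) /=; last first.
    by rewrite -dvdn_divisors ?dvdn_gcdr.
  by rewrite /close_multiplier x_gt0 eqxx /=; apply: leq_addr.
rewrite exchange_big /=; apply: leq_sum => h _.
rewrite -sum1dep_card [leqRHS]big_mkcond [leqLHS]big_mkcond; apply: leq_sum => x _.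
by case: (0 < x)%N; case: close_multiplier.
Qed.

Lemma sqr_addn_le (a c : nat) : ((a + c) ^ 2 <= 2 * a ^ 2 + 2 * c ^ 2)%N.
Proof. by rewrite sqrnD; have [h _] := nat_Cauchy a c; lia. Qed.

(** Two applications of Cauchy-Schwarz, over the dyadic scales and over the
    divisors of [q], reduce to [count_triples]. The number of scales is a number
    of divisors too, by [size_divisors_exp2], and hence is at most [D]. *)
Lemma weyl_sum_moment (q M D : nat) : odd q -> (M <= q)%N ->
  (forall n, 0 < n <= q ^ 2 -> size (divisors n) <= D)%N ->
  (\sum_(b < q | coprime b q) (M + 2 * weyl_sum q M b) ^ 2 <= 242 * D ^ 5 * q * M ^ 2)%N.
Proof.
move=> oq le_Mq tauD; have q_gt0 : (0 < q)%N by case: (q) oq.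
have D_gt0 : (0 < D)%N by apply: (tauD 1%N); rewrite expn_gt0 q_gt0.
have [->|M_gt0] := posnP M.
  by rewrite big1 // => b _; rewrite /weyl_sum big_ord0.
set L := (trunc_log 2 M).+1.
have q2 : (q <= q ^ 2)%N by rewrite -mulnn leq_pmull.
have le_LD : (L <= D)%N.
  apply: leq_trans (size_divisors_exp2 _) (tauD _ _).
  rewrite expn_gt0 /= (leq_trans _ q2) // (leq_trans _ le_Mq) //.
  exact: trunc_logP.
have le_qD : (size (divisors q) <= D)%N by apply: tauD; rewrite q_gt0 q2.
pose N (j : nat) h b := #|[set x : 'I_M | close_multiplier q (2 ^ j) h b x]|.
have W2 (b : 'I_q) : coprime b q ->
    (weyl_sum q M b ^ 2 <=
      \sum_(j < L) \sum_(h <- divisors q) D ^ 2 * ((2 ^ j) ^ 2 * N j h b ^ 2))%N.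
  move=> cb.
  have le_w : (weyl_sum q M b <= \sum_(j < L) 2 ^ j * \sum_(h <- divisors q) N j h b)%N.
    by apply: weyl_sum_le; rewrite // M_gt0.
  rewrite -leq_sqr in le_w; apply: leq_trans le_w _.
  apply: leq_trans (sqr_sum_le _ _) _.
  rewrite [size _](_ : _ = L); last by rewrite /index_enum -enumT size_enum_ord.
  apply: (leq_trans (leq_mul le_LD (leqnn _))).
  rewrite big_distrr; apply: leq_sum => j _ /=.
  have -> : (\sum_(h <- divisors q) D ^ 2 * ((2 ^ j) ^ 2 * N j h b ^ 2)
      = D * ((2 ^ j) ^ 2 * (D * \sum_(h <- divisors q) N j h b ^ 2)))%N.
    by rewrite -2!big_distrr /=; ring.
  rewrite expnMn; apply: leq_mul => //; apply: leq_mul => //.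
  apply: leq_trans (sqr_sum_le _ _) _.
  by rewrite leq_mul.
apply: (@leq_trans (\sum_(b < q | coprime b q) (2 * M ^ 2 + 8 * weyl_sum q M b ^ 2))).
  apply: leq_sum => b _; apply: leq_trans (sqr_addn_le _ _) _.
  by rewrite expnMn mulnA.
rewrite big_split /= -[X in (_ + X <= _)%N]big_distrr /=.
have le1 : (\sum_(b < q | coprime b q) 2 * M ^ 2 <= 2 * (q * M ^ 2))%N.
  rewrite sum_nat_const mulnCA !leq_mul // -[leqRHS](card_ord q).
  by apply: max_card.
have le2 : (\sum_(b < q | coprime b q) weyl_sum q M b ^ 2 <= 30 * D ^ 5 * q * M ^ 2)%N.
  apply: leq_trans (leq_sum _ W2) _.
  rewrite exchange_big /=.
  apply: (@leq_trans (\sum_(j < L) \sum_(h <- divisors q) D ^ 2 * (30 * D * q * M ^ 2))).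
    apply: leq_sum => j _; rewrite exchange_big /= big_seq [leqRHS]big_seq.
    apply: leq_sum => h; rewrite -dvdn_divisors // => hq.
    rewrite -big_distrr /= leq_mul2l -big_distrr /= count_triples ?orbT //.
    rewrite expn_gt0 /=; apply: leq_trans (trunc_logP (isT : 1 < 2)%N M_gt0).
    by rewrite leq_pexp2l // -ltnS.
  rewrite sum_nat_const card_ord big_const_seq count_predT iter_addn_0.
  rewrite [(_ * size _)%N]mulnC.
  have := leq_mul le_LD (leq_mul le_qD (leqnn (D ^ 2 * (30 * D * q * M ^ 2))%N)).
  by move/leq_trans; apply; apply: eq_leq; ring.
have le3 : (q * M ^ 2 <= D ^ 5 * q * M ^ 2)%N.
  by rewrite -mulnA leq_pmull // expn_gt0 D_gt0.
move: le1 le2 le3; rewrite -!(mulnA _ q).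
move: (\sum_(b < q | _) _)%N (\sum_(b < q | _) _)%N (q * M ^ 2)%N (D ^ 5)%N => a b c d.
rewrite -!mulnA; move: (d * c)%N => e; lia.
Qed.

(** * Rearrangements of sums and elementary inequalities *)

(** Summation over a square along its diagonals [m - n = x] and [n - m = x]. *)
Lemma sum_square_diagonals (V : zmodType) (F : nat -> nat -> V) M :
  \sum_(0 <= m < M) \sum_(0 <= n < M) F m n
    = \sum_(0 <= m < M) F m m
      + \sum_(1 <= x < M) \sum_(0 <= n < M - x) (F (n + x)%N n + F n (n + x)%N).
Proof.
elim: M => [|M IHM]; first by rewrite !big_nil addr0.
rewrite big_nat_recr //= [in RHS]big_nat_recr //=.
have -> : \sum_(0 <= i < M) \sum_(0 <= n < M.+1) F i n =
   \sum_(0 <= i < M) \sum_(0 <= n < M) F i n + \sum_(0 <= i < M) F i M.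
  by rewrite -big_split; apply: eq_bigr => i _; rewrite big_nat_recr.
rewrite IHM [\sum_(0 <= n < M.+1) F M n]big_nat_recr //=.
have -> : \sum_(1 <= x < M.+1) \sum_(0 <= n < M.+1 - x) (F (n + x)%N n + F n (n + x)%N)
   = \sum_(1 <= x < M) \sum_(0 <= n < M - x) (F (n + x)%N n + F n (n + x)%N)
     + \sum_(0 <= n < M) (F M n + F n M).
  have -> : \sum_(1 <= x < M) \sum_(0 <= n < M - x) (F (n + x)%N n + F n (n + x)%N)
     = \sum_(1 <= x < M.+1) \sum_(0 <= n < M - x) (F (n + x)%N n + F n (n + x)%N).
    case: M {IHM} => [|M]; first by rewrite !big_geq.
    by rewrite [RHS]big_nat_recr //= subnn [X in _ + X]big_geq ?addr0.
  rewrite [X in _ + X]big_nat_rev /= add0n.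
  rewrite [X in _ + X](_ : _ = \sum_(1 <= x < M.+1) (F M (M - x)%N + F (M - x)%N M)); last first.
    by rewrite big_add1 /=; apply: eq_bigr => i _.
  rewrite -big_split; apply: eq_big_nat => x /andP[x1 xM].
  by rewrite subSn // big_nat_recr //= subnK.
rewrite big_split /=.
rewrite [RHS]addrACA -!addrA; congr (_ + _); congr (_ + _).
by rewrite [RHS]addrC addrA [X in X + _]addrC.
Qed.

Lemma sum_shift_period (V : zmodType) (f : nat -> V) q n :
  (forall i, f (i + q)%N = f i) -> \sum_(0 <= i < q) f (i + n)%N = \sum_(0 <= i < q) f i.
Proof.
move=> per; elim: n => [|n IHn]; first by under eq_bigr do rewrite addn0.
rewrite -IHn; case: q per {IHn} => [|q] per; first by rewrite !big_geq.
rewrite big_nat_recr //= [RHS]big_nat_recl // addrC; congr (_ + _).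
  by rewrite -(per n); congr f; lia.
by apply: eq_bigr => i _; congr f; lia.
Qed.

Lemma sum_period_mul (V : zmodType) (f : nat -> V) q t :
  (forall i, f (i + q)%N = f i) -> \sum_(0 <= i < t * q) f i = (\sum_(0 <= i < q) f i) *+ t.
Proof.
move=> per; elim: t => [|t IHt]; first by rewrite mul0n big_geq.
rewrite mulSn addnC (@big_cat_nat _ _ _ (t * q)%N) ?leq_addr //= IHt mulrSr.
congr (_ + _); rewrite -{1}[(t * q)%N]add0n big_addn addnC addnK.
exact: sum_shift_period.
Qed.

Lemma sqr_add_le (F : numDomainType) (a c : F) : 0 <= a -> 0 <= c ->
  (a + c) ^+ 2 <= 2 * (a ^+ 2 + c ^+ 2).
Proof.
move=> a0 c0; rewrite -subr_ge0.
have -> : 2 * (a ^+ 2 + c ^+ 2) - (a + c) ^+ 2 = (a - c) ^+ 2 by ring.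
by rewrite real_exprn_even_ge0 // rpredB // ger0_real.
Qed.

Lemma pow4_add_le (F : numDomainType) (a c : F) : 0 <= a -> 0 <= c ->
  (a + c) ^+ 4 <= 8 * (a ^+ 4 + c ^+ 4).
Proof.
move=> a0 c0; rewrite -[4%N]/(2 * 2)%N !exprM.
apply: (@le_trans _ _ ((2 * (a ^+ 2 + c ^+ 2)) ^+ 2)).
  by rewrite ler_pXn2r ?sqr_add_le ?nnegrE ?mulr_ge0 ?addr_ge0 ?exprn_ge0.
have -> : 8 = 2 ^+ 2 * 2 :> F by ring.
by rewrite exprMn -mulrA ler_wpM2l ?exprn_ge0 // sqr_add_le ?exprn_ge0.
Qed.

(** The [a] below [d * q] with [gcd(a, d * q) = d] are the [d * b] with [b] below
    [q] and coprime to [q]: the fractions [a / (d * q)] of exact denominator [q]. *)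
Lemma sum_gcd_class (V : zmodType) (F : nat -> V) d q : (0 < d)%N -> (0 < q)%N ->
  \sum_(a < d * q | gcdn a (d * q) == d) F a = \sum_(b < q | coprime b q) F (d * b)%N.
Proof.
move=> d_gt0 q_gt0.
rewrite -(big_mkord (fun a => gcdn a (d * q) == d) F).
rewrite -(big_mkord (fun b => coprime b q) (fun b => F (d * b)%N)).
rewrite -big_filter -[RHS]big_filter -(big_map (muln d) xpredT F).
apply: perm_big; apply: uniq_perm.
- by rewrite filter_uniq ?iota_uniq.
- rewrite map_inj_uniq ?filter_uniq ?iota_uniq // => x y /eqP.
  by rewrite eqn_pmul2l // => /eqP.
move=> a; rewrite mem_filter mem_index_iota; apply/andP/mapP.
  case=> /eqP gE lt_a; have /dvdnP[b aE] : (d %| a)%N by rewrite -gE dvdn_gcdl.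
  exists b; last by rewrite mulnC.
  rewrite mem_filter mem_index_iota /coprime -(eqn_pmul2l d_gt0) muln_gcdr muln1.
  by rewrite -(mulnC b) -aE gE eqxx /= -(ltn_pmul2l d_gt0) mulnC -aE.
case=> b; rewrite mem_filter mem_index_iota => /andP[cb lt_b] ->.
by rewrite -muln_gcdr (eqP cb) muln1 ltn_pmul2l.
Qed.

Lemma sqr_sub_ge0 (F : numDomainType) (x y : F) : 0 <= x -> 0 <= y -> 0 <= (x - y) ^+ 2.
Proof. by move=> x0 y0; rewrite real_exprn_even_ge0 // rpredB // ger0_real. Qed.

Lemma mul_le_sqr (F : numDomainType) (x y : F) : 0 <= x -> 0 <= y ->
  x * y <= x ^+ 2 + y ^+ 2.
Proof.
move=> x0 y0; rewrite -subr_ge0.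
have -> : x ^+ 2 + y ^+ 2 - x * y = (x - y) ^+ 2 + x * y by ring.
by apply: addr_ge0; [apply: sqr_sub_ge0 | apply: mulr_ge0].
Qed.

Lemma sqr_add3_le (F : numDomainType) (x y z : F) : 0 <= x -> 0 <= y -> 0 <= z ->
  (x + y + z) ^+ 2 <= 3 * (x ^+ 2 + y ^+ 2 + z ^+ 2).
Proof.
move=> x0 y0 z0; rewrite -subr_ge0.
have -> : 3 * (x ^+ 2 + y ^+ 2 + z ^+ 2) - (x + y + z) ^+ 2
   = (x - y) ^+ 2 + (y - z) ^+ 2 + (x - z) ^+ 2 by ring.
by apply: addr_ge0; [apply: addr_ge0|]; apply: sqr_sub_ge0.
Qed.

Lemma eq_of_dvd_dist (q c c' : nat) : (c < q.+1)%N -> (c' < q.+1)%N ->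
  (0 < c)%N -> (0 < c')%N -> (q %| absz (c%:Z - c'%:Z)%R)%N -> c = c'.
Proof.
move=> lt_c lt_c' c_gt0 c'_gt0 dv; apply/eqP/negPn/negP => ne.
have : (0 < absz (c%:Z - c'%:Z)%R)%N by lia.
by move/dvdn_leq/(_ dv); lia.
Qed.

(** * Additive characters *)

Section ExponentialSums.

Variable R : realType.
Local Notation C := R[i].
Local Open Scope complex_scope.

(** The additive character [exp (2 i pi z / q)]. *)
Definition expi (q : nat) (z : int) : C :=
  let t := pi *+ 2 * z%:~R / q%:R in (cos t) +i* (sin t).

Lemma expi0 q : expi q 0 = 1.
Proof. by rewrite /expi mulr0 mul0r cos0 sin0. Qed.

Lemma expiD q y z : expi q (y + z) = expi q y * expi q z.
Proof.
rewrite /expi; simpc; rewrite intrD mulrDr mulrDl cosD sinD.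
by apply/eqP; rewrite eq_complex /= eqxx /= addrC; apply/eqP; congr (_ + _); rewrite mulrC.
Qed.

Lemma norm_expi q z : `|expi q z| = 1.
Proof. by rewrite normc_def /= cos2Dsin2 sqrtr1. Qed.

Lemma expiN q z : expi q (- z) = (expi q z)^*%R.
Proof.
have nz : expi q z != 0 by rewrite -normr_gt0 norm_expi.
apply: (mulfI nz); rewrite -expiD subrr expi0 -normCK norm_expi expr1n //.
Qed.

Lemma expiX q z n : expi q z ^+ n = expi q (z * n%:Z).
Proof.
elim: n => [|n IHn]; first by rewrite mulr0 expi0.
by rewrite exprS IHn -expiD -[in RHS]addn1 PoszD mulrDr mulr1 addrC.
Qed.

Lemma expi_period q : (0 < q)%N -> expi q q%:Z = 1.
Proof.
move=> q_gt0; rewrite /expi mulfK ?pnatr_eq0 -?lt0n //.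
by rewrite cos2pi sin2pi.
Qed.

Lemma expi_dvd q z : (0 < q)%N -> (q %| z)%Z -> expi q z = 1.
Proof.
move=> q_gt0 /dvdzP[k ->].
have en (n : nat) : expi q (n%:Z * q%:Z) = 1 by rewrite mulrC -expiX expi_period // expr1n.
by case: k => n; rewrite ?en // NegzE mulNr expiN en rmorph1.
Qed.

Lemma expi_mod q y z : (0 < q)%N -> (q %| y - z)%Z -> expi q y = expi q z.
Proof. by move=> q_gt0 dv; rewrite -[y](subrK z) expiD expi_dvd ?mul1r. Qed.

Lemma expi_scale d q z : (0 < d)%N -> expi (d * q) (d%:Z * z) = expi q z.
Proof.
move=> d_gt0; rewrite /expi natrM intrM.
suff -> : pi *+ 2 * (d%:Z%:~R * z%:~R) / (d%:R * q%:R) = pi *+ 2 * z%:~R / q%:R :> R by [].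
by rewrite mulrCA -mulf_div divff ?mul1r // pnatr_eq0 -lt0n.
Qed.

(** The angle lies between a quarter turn and a half turn, where the cosine is
    nonpositive. *)
Lemma norm_expi_sub1_far q n :
  (0 < q)%N -> (q <= 4 * n)%N -> (2 * n <= q)%N -> 1 <= `|expi q n%:Z - 1|.
Proof.
move=> q_gt0 lo hi; have q_pos : 0 < q%:R :> R by rewrite ltr0n.
rewrite normc_def -[1]/(1%:C) lecR /=.
set t := _ / _; have cos_le0 : cos t <= 0.
  rewrite -oppr_ge0 -cosDpi; rewrite -[t + pi](subrK (pi *+ 2)) cosD2pi.
  apply: cos_ge0_pihalf; rewrite /t.
  have pi0 : 0 < pi :> R by exact: pi_gt0.
  have lo' : 1 / 4 <= n%:R / q%:R :> R.
    by rewrite ler_pdivlMr // mulrAC ler_pdivrMr // mul1r -natrM ler_nat mulnC.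
  have hi' : n%:R / q%:R <= 1 / 2 :> R.
    by rewrite ler_pdivrMr // mulrAC mul1r ler_pdivlMr // -natrM ler_nat mulnC.
  rewrite -mulrA; move: lo' hi'; rewrite pmulrn; move: (n%:~R / q%:R) => y lo' hi'.
  by apply/andP; split; nra.
have := cos2Dsin2 t => cs.
rewrite -[X in X <= _]sqrtr1; apply: ler_wsqrtr; nra.
Qed.

(** Substitute for a lower bound of the sine. With [r] the distance and
    [k = q %/ (2 * r)], the multiple [k * r] lies between [q / 4] and [q / 2];
    and [|w ^ k - 1| <= k * |w - 1|] for [w] on the unit circle. *)
Lemma norm_expi_sub1 q z : (0 < q)%N -> (0 < dist q z)%N ->
  1 <= (q %/ (2 * dist q z))%:R * `|expi q z - 1|.
Proof.
move=> q_gt0; set r := dist q z => r_gt0.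
have -> : `|expi q z - 1| = `|expi q r%:Z - 1|.
  rewrite (expi_mod q_gt0 (dvdz_sub_centered q z)) /r /dist.
  case: (centered q z) => n; first by rewrite absz_nat.
  by rewrite NegzE abszN absz_nat expiN -[LHS]norm_conjC rmorphB /= conjCK rmorph1.
have r2 : (2 * r <= q)%N by rewrite mulnC dist_le_half.
set k := (q %/ (2 * r))%N.
have k_lo : (k * (2 * r) <= q)%N := leq_trunc_div q (2 * r).
have k_hi : (q < k.+1 * (2 * r))%N by rewrite ltn_ceil // muln_gt0.
have k_gt0 : (0 < k)%N by rewrite divn_gt0 // muln_gt0.
apply: (@le_trans _ _ `|expi q (r * k)%N%:Z - 1|).
  by apply: norm_expi_sub1_far => //; nia.
rewrite PoszM -expiX subrX1 normrM mulrC ler_wpM2r //.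
apply: le_trans (ler_norm_sum _ _ _) _.
under eq_bigr do rewrite normrX norm_expi expr1n.
by rewrite sumr_const card_ord.
Qed.

Lemma expi_neq1 q z : (0 < q)%N -> ~~ (q %| z)%Z -> expi q z != 1.
Proof.
move=> q_gt0 /dist_gt0 /(norm_expi_sub1 q_gt0); rewrite -subr_eq0 -normr_eq0.
by case: eqP => // ->; rewrite mulr0 ler10.
Qed.

Lemma norm_geom_le q z L : (0 < q)%N -> (0 < dist q z)%N ->
  `|\sum_(n < L) expi q (z * n%:Z)| <= (q %/ dist q z)%:R.
Proof.
move=> q_gt0 r_gt0; have h := norm_expi_sub1 q_gt0 r_gt0.
set k := (q %/ _)%N in h.
have kk : (2 * k <= q %/ dist q z)%N.
  by rewrite leq_divRL // mulnAC mulnC leq_trunc_div.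
have geo : `|expi q z - 1| * `|\sum_(n < L) expi q (z * n%:Z)| <= 2.
  under eq_bigr do rewrite -expiX.
  rewrite -normrM -subrX1; apply: le_trans (ler_normB _ _) _.
  by rewrite normrX norm_expi expr1n normr1.
apply: (@le_trans _ _ (2 * k)%:R); last by rewrite ler_nat.
rewrite -[X in X <= _]mul1r; apply: le_trans (ler_wpM2r (normr_ge0 _) h) _.
by rewrite -mulrA natrM mulrC ler_wpM2r // ler0n.
Qed.

Lemma sum_expi q z : (0 < q)%N -> \sum_(n < q) expi q (z * n%:Z) = if (q %| z)%Z then q%:R else 0.
Proof.
move=> q_gt0; case: ifP => [dv|/negbT ndv].
  under eq_bigr => n _ do rewrite expi_dvd ?dvdz_mulr //.
  by rewrite sumr_const card_ord.
have /negPf nz := expi_neq1 q_gt0 ndv.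
apply/eqP; have /eqP := subrX1 (expi q z) q.
rewrite expiX expi_dvd ?dvdz_mull // subrr eq_sym mulf_eq0 subr_eq0 nz /=.
by under eq_bigr do rewrite expiX.
Qed.

(** * Quadratic Gauss sums *)

(** The incomplete quadratic Gauss sum over [1 <= m <= M]; the index is shifted
    by one. *)
Definition gauss (q b M : nat) : C := \sum_(0 <= m < M) expi q (b%:Z * m.+1%:Z ^+ 2).

Lemma sqnorm_gauss q b M :
  `|gauss q b M| ^+ 2 = \sum_(0 <= m < M) \sum_(0 <= n < M)
     expi q (b%:Z * (m.+1%:Z ^+ 2 - n.+1%:Z ^+ 2)).
Proof.
rewrite normCK /gauss rmorph_sum mulr_suml; apply: eq_bigr => m _.
rewrite mulr_sumr; apply: eq_bigr => n _ /=.
by rewrite -expiN -expiD -mulrBr.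
Qed.

(** On the diagonal [m - n = x] the phase [b * (m ^ 2 - n ^ 2)] is linear in [n],
    of slope [2 * b * x], so each diagonal is a geometric sum; the main diagonal
    contributes [M]. *)
Lemma weyl_ineq q b M : odd q -> coprime b q -> (M <= q)%N ->
  `|gauss q b M| ^+ 2 <= (M + 2 * weyl_sum q M b)%:R.
Proof.
move=> oq cb le_Mq; have q_gt0 : (0 < q)%N by case: (q) oq.
have ge0 : 0 <= `|gauss q b M| ^+ 2 by rewrite exprn_ge0.
rewrite -[X in X <= _](ger0_norm ge0) sqnorm_gauss sum_square_diagonals natrD.
apply: le_trans (ler_normD _ _) _; apply: lerD.
  apply: le_trans (ler_norm_sum _ _ _) _.
  by under eq_bigr do rewrite norm_expi; rewrite sumr_const_nat subn0.
apply: le_trans (ler_norm_sum _ _ _) _.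
rewrite /weyl_sum big_distrr natr_sum /= -(big_mkord (fun x => 0 < x)%N
  (fun x => (2 * minn M (q %/ dist q (2 * b * x)%N%:Z))%:R : C)).
rewrite [leRHS](_ : _ = \sum_(1 <= x < M)
    (2 * minn M (q %/ dist q (2 * b * x)%N%:Z))%:R); last first.
  case: (M) => [|M']; first by rewrite !big_geq.
  rewrite big_mkcond big_nat_recl //= add0r big_add1 /=.
  by apply: eq_bigr.
rewrite big_nat_cond [leRHS]big_nat_cond; apply: ler_sum => x.
rewrite andbT => /andP[x_gt0 lt_xM].
have d_gt0 : (0 < dist q (2 * b * x)%N%:Z)%N.
  by apply: dist_gt0; rewrite dvdz_double_mul // gtnNdvd // (leq_trans lt_xM).
set s := \sum_(0 <= n < M - x) expi q ((2 * b * x)%N%:Z * n%:Z).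
have sE : \sum_(0 <= n < M - x) expi q (b%:Z * ((n + x).+1%:Z ^+ 2 - n.+1%:Z ^+ 2))
   = expi q (b%:Z * x%:Z * (x%:Z + 2)) * s.
  rewrite mulr_sumr; apply: eq_bigr => n _; rewrite -expiD; congr (expi _ _).
  by rewrite !intS !PoszM !PoszD; ring.
have sE' : \sum_(0 <= n < M - x) expi q (b%:Z * (n.+1%:Z ^+ 2 - (n + x).+1%:Z ^+ 2))
   = (expi q (b%:Z * x%:Z * (x%:Z + 2)) * s)^*%R.
  rewrite -sE rmorph_sum; apply: eq_bigr => n _; rewrite -[RHS]expiN; congr (expi _ _).
  by ring.
rewrite big_split /= sE sE'; apply: le_trans (ler_normD _ _) _.
rewrite norm_conjC normrM norm_expi mul1r -mulr2n natrM -[X in X <= _]mulr_natl.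
rewrite ler_pM2l ?ltr0n //.
rewrite /minn; case: ifP => _.
  rewrite /s; apply: le_trans (ler_norm_sum _ _ _) _.
  by under eq_bigr do rewrite norm_expi; rewrite sumr_const_nat subn0 ler_nat leq_subr.
by rewrite /s big_mkord; apply: norm_geom_le.
Qed.

Lemma gauss_period q b i : (0 < q)%N ->
  expi q (b%:Z * (i + q).+1%:Z ^+ 2) = expi q (b%:Z * i.+1%:Z ^+ 2).
Proof.
move=> q_gt0; apply: expi_mod => //; apply/dvdzP.
exists (b%:Z * (2 * i.+1%:Z + q%:Z)).
by rewrite !intS !PoszD; ring.
Qed.

(** For a complete sum the diagonals can be taken cyclically, so all geometric
    sums are complete and only the one with [q %| x] survives. *)
Lemma sqnorm_gauss_full q b : odd q -> coprime b q -> `|gauss q b q| ^+ 2 = q%:R.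
Proof.
move=> oq cb; have q_gt0 : (0 < q)%N by case: (q) oq.
rewrite sqnorm_gauss exchange_big /=.
transitivity (\sum_(0 <= n < q) \sum_(0 <= x < q)
   expi q (b%:Z * x%:Z ^+ 2 + (2 * b * x)%N%:Z * n.+1%:Z)).
  apply: eq_bigr => n _.
  pose f m := expi q (b%:Z * (m.+1%:Z ^+ 2 - n.+1%:Z ^+ 2)).
  rewrite -(@sum_shift_period _ f q n); last first.
    by move=> i; rewrite /f !mulrBr !expiD gauss_period.
  apply: eq_bigr => x _; rewrite /f; congr (expi _ _).
  by rewrite !intS !PoszM !PoszD; ring.
rewrite exchange_big /=.
transitivity (\sum_(0 <= x < q) expi q (b%:Z * x%:Z ^+ 2 + (2 * b * x)%N%:Z)
    * (if (q %| x)%N then q%:R else 0)).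
  apply: eq_bigr => x _; rewrite -(dvdz_double_mul x oq cb) -sum_expi // mulr_sumr.
  rewrite big_mkord; apply: eq_bigr => n _; rewrite -expiD; congr (expi _ _).
  by rewrite intS; ring.
rewrite big_ltn // dvdn0 muln0 expr0n mulr0 addr0 expi0 mul1r.
rewrite big_nat_cond big1 ?addr0 // => x /andP[/andP[x_gt0 lt_xq] _].
by rewrite gtnNdvd // mulr0.
Qed.

Lemma gauss_fold q b M : (0 < q)%N ->
  gauss q b M = (M %/ q)%:R * gauss q b q + gauss q b (M %% q).
Proof.
move=> q_gt0; rewrite /gauss {1}(divn_eq M q).
rewrite (@big_cat_nat _ _ _ (M %/ q * q)%N) ?leq_addr //=.
rewrite sum_period_mul => [|i]; last exact: gauss_period.
rewrite mulr_natl; congr (_ + _).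
rewrite -{1}[(M %/ q * q)%N]add0n big_addn addnC addnK.
have per t i : expi q (b%:Z * (i + t * q).+1%:Z ^+ 2) = expi q (b%:Z * i.+1%:Z ^+ 2).
  by elim: t => [|t IHt]; rewrite ?mul0n ?addn0 // mulSn addnCA addnC gauss_period.
by apply: eq_bigr => i _; rewrite per.
Qed.

Lemma gauss_scale d q b M : (0 < d)%N -> gauss (d * q) (d * b) M = gauss q b M.
Proof.
by move=> d_gt0; apply: eq_bigr => i _; rewrite PoszM -mulrA expi_scale.
Qed.

(** The incomplete Gauss sum minus its expected value, the proportion [M / q] of
    the complete sum. *)
Definition gauss_err q b M : C := gauss q b M - M%:R / q%:R * gauss q b q.

(** Reduction to primitive frequencies. For [a / (d * q)] with reduced form
    [b / q], the complete blocks of length [q] give multiples of the complete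
    sum, and what deviates from the proportional share comes from the last,
    incomplete block only. *)
Lemma gauss_split d q b M : (0 < d)%N -> (0 < q)%N ->
  gauss (d * q) (d * b) M = M%:R / q%:R * gauss q b q + gauss_err q b (M %% q).
Proof.
move=> d_gt0 q_gt0; rewrite gauss_scale // gauss_fold // /gauss_err.
have q0 : q%:R != 0 :> C by rewrite pnatr_eq0 -lt0n.
rewrite {3}(divn_eq M q) natrD natrM mulrDl mulfK //; ring.
Qed.

(** The arithmetic heart of the proof: on average over [b] coprime to [q] the error
    has the order of the square root of [M], up to a power of [D]. *)
Lemma sum_pow4_gauss_err q M D : odd q -> (M <= q)%N ->
  (forall n, 0 < n <= q ^ 2 -> size (divisors n) <= D)%N ->
  \sum_(b < q | coprime b q) `|gauss_err q b M| ^+ 4 <= (1944 * D ^ 5 * q * M ^ 2)%:R.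
Proof.
move=> oq le_Mq tauD; have q_gt0 : (0 < q)%N by case: (q) oq.
have q_pos : 0 < q%:R :> C by rewrite ltr0n.
have D_gt0 : (0 < D)%N by apply: (tauD 1%N); rewrite expn_gt0 q_gt0.
have err b : coprime b q ->
    `|gauss_err q b M| ^+ 4 <= (8 * ((M + 2 * weyl_sum q M b) ^ 2 + M ^ 2))%:R.
  move=> cb; set z := gauss q b M; set w := M%:R / q%:R * gauss q b q.
  have zle : `|z| ^+ 4 <= ((M + 2 * weyl_sum q M b) ^ 2)%:R.
    rewrite natrX -[4%N]/(2 * 2)%N exprM ler_pXn2r ?nnegrE ?exprn_ge0 ?ler0n //.
    exact: weyl_ineq.
  have wle : `|w| ^+ 4 <= (M ^ 2)%:R.
    rewrite -[4%N]/(2 * 2)%N exprM natrX ler_pXn2r ?nnegrE ?exprn_ge0 ?ler0n //.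
    rewrite normrM exprMn sqnorm_gauss_full // normrM normfV !normr_nat.
    rewrite expr_div_n expr2 [X in _ / X]expr2 invfM -!mulrA mulVf ?gt_eqF // mulr1.
    rewrite mulrA ler_pdivrMr // -expr2 expr2 ler_wpM2l ?ler0n // ler_nat //.
  have tri : `|gauss_err q b M| <= `|z| + `|w| by apply: ler_normB.
  apply: (@le_trans _ _ ((`|z| + `|w|) ^+ 4)).
    by rewrite ler_pXn2r ?nnegrE ?addr_ge0.
  apply: le_trans (pow4_add_le (normr_ge0 z) (normr_ge0 w)) _.
  by rewrite natrM ler_wpM2l ?ler0n // natrD lerD.
apply: (@le_trans _ _ (\sum_(b < q | coprime b q)
    (8 * ((M + 2 * weyl_sum q M b) ^ 2 + M ^ 2))%:R)).
  by apply: ler_sum => b; apply: err.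
rewrite -natr_sum ler_nat -big_distrr /= big_split /=.
have le1 := weyl_sum_moment oq le_Mq tauD.
have le2 : (\sum_(b < q | coprime b q) M ^ 2 <= q * M ^ 2)%N.
  rewrite sum_nat_const leq_mul // -[leqRHS](card_ord q); exact: max_card.
have le3 : (q * M ^ 2 <= D ^ 5 * q * M ^ 2)%N.
  by rewrite -mulnA leq_pmull // expn_gt0 D_gt0.
move: le1 le2 le3; rewrite -!(mulnA _ q).
move: (\sum_(b < q | _) _)%N (\sum_(b < q | _) _)%N (q * M ^ 2)%N (D ^ 5)%N => a b c d.
rewrite -!mulnA; move: (d * c)%N => f; lia.
Qed.

(** * The Fourier transform of the discrepancy *)

(** The Fourier transform, in [c], of the signed discrepancy: the number of
    solutions transforms into the product of two Gauss sums. *)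
Definition discr_hat q M N a : C :=
  gauss q a M * (gauss q a N)^*%R
  - M%:R * N%:R / q%:R ^+ 2 * `|gauss q a q| ^+ 2.

Lemma gauss_full_scale d q b : (0 < d)%N -> (0 < q)%N ->
  gauss (d * q) (d * b) (d * q) = d%:R * gauss q b q.
Proof.
move=> d_gt0 q_gt0; rewrite gauss_scale // gauss_fold // mulnK // modnMl.
by rewrite [X in _ + X]big_geq // addr0.
Qed.

(** Split both Gauss sums into main term and error. The product of the main terms
    is exactly the subtracted expected value. The complete sum has modulus the
    square root of [q], so a cross term is [M / q] times the square root of [q]
    times an error, and [q * y ^ 2 <= q ^ 2 + y ^ 4] reduces it to fourth powers. *)
Lemma sqnorm_discr_hat_le d q b M N : (0 < d)%N -> odd q -> coprime b q ->
  let x := `|gauss_err q b (M %% q)| in let y := `|gauss_err q b (N %% q)| in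
  `|discr_hat (d * q) M N (d * b)| ^+ 2 <=
    3 * (M%:R ^+ 2 + N%:R ^+ 2 + ((N%:R / q%:R) ^+ 2 + 1) * x ^+ 4
         + ((M%:R / q%:R) ^+ 2 + 1) * y ^+ 4).
Proof.
move=> d_gt0 oq cb; have q_gt0 : (0 < q)%N by case: (q) oq.
have q0 : q%:R != 0 :> C by rewrite pnatr_eq0 -lt0n.
have d0 : d%:R != 0 :> C by rewrite pnatr_eq0 -lt0n.
rewrite /discr_hat gauss_full_scale // !gauss_split //.
set s := gauss_err q b (M %% q); set t := gauss_err q b (N %% q); set x := `|s|; set y := `|t|.
set G := gauss q b q; set u : C := M%:R / q%:R; set v : C := N%:R / q%:R.
have u_ge0 : 0 <= u by rewrite divr_ge0 ?ler0n.
have v_ge0 : 0 <= v by rewrite divr_ge0 ?ler0n.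
have -> : (u * G + s) * (v * G + t)^*%R - M%:R * N%:R / (d * q)%:R ^+ 2 * `|d%:R * G| ^+ 2
   = u * (G * t^*%R) + v * (s * G^*%R) + s * t^*%R.
  have -> : M%:R * N%:R / (d * q)%:R ^+ 2 * `|d%:R * G| ^+ 2 = u * v * (G * G^*%R).
    by rewrite normrM exprMn normr_nat normCK natrM /u /v; field; rewrite q0 d0.
  rewrite rmorphD rmorphM /= (geC0_conj v_ge0); ring.
have g2 : `|G| ^+ 2 = q%:R by apply: sqnorm_gauss_full.
have uq : u ^+ 2 * q%:R ^+ 2 = M%:R ^+ 2 by rewrite -exprMn divfK.
have vq : v ^+ 2 * q%:R ^+ 2 = N%:R ^+ 2 by rewrite -exprMn divfK.
clearbody u v.
have x_ge0 : 0 <= x := normr_ge0 _; have y_ge0 : 0 <= y := normr_ge0 _.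
have h1 := mulr_ge0 u_ge0 (mulr_ge0 (normr_ge0 G) y_ge0).
have h2 := mulr_ge0 v_ge0 (mulr_ge0 x_ge0 (normr_ge0 G)).
have h3 := mulr_ge0 x_ge0 y_ge0.
apply: (@le_trans _ _ ((u * (`|G| * y) + v * (x * `|G|) + x * y) ^+ 2)).
  rewrite ler_pXn2r ?nnegrE ?(addr_ge0 (addr_ge0 h1 h2) h3) //.
  apply: le_trans (ler_normD _ _) _; apply: lerD; last by rewrite normrM norm_conjC.
  apply: le_trans (ler_normD _ _) _.
  rewrite (normrM u) (normrM v) (ger0_norm u_ge0) (ger0_norm v_ge0).
  by rewrite (normrM G) (normrM s) !norm_conjC.
apply: le_trans (sqr_add3_le h1 h2 h3) _.
apply: ler_wpM2l; first by rewrite ler0n.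
have b1 : (u * (`|G| * y)) ^+ 2 <= M%:R ^+ 2 + u ^+ 2 * y ^+ 4.
  rewrite !exprMn g2 -uq -mulrDr ler_wpM2l ?exprn_ge0 //.
  by rewrite -[4%N]/(2 * 2)%N [y ^+ (_ * _)]exprM mul_le_sqr ?ler0n ?exprn_ge0.
have b2 : (v * (x * `|G|)) ^+ 2 <= N%:R ^+ 2 + v ^+ 2 * x ^+ 4.
  rewrite !exprMn g2 -vq -mulrDr ler_wpM2l ?exprn_ge0 // mulrC.
  by rewrite -[4%N]/(2 * 2)%N [x ^+ (_ * _)]exprM mul_le_sqr ?ler0n ?exprn_ge0.
have b3 : (x * y) ^+ 2 <= x ^+ 4 + y ^+ 4.
  by rewrite exprMn -[4%N]/(2 * 2)%N !exprM mul_le_sqr ?exprn_ge0.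
apply: le_trans (lerD (lerD b1 b2) b3) _.
by rewrite le_eqVlt; apply/orP; left; apply/eqP; ring.
Qed.

(** The fourth moment of the error carries the factor [(M %% q) ^ 2]: it is at
    most [q ^ 2], which absorbs the denominator of [(N / q) ^ 2], and it is at
    most [M ^ 2], which serves the other summand. *)
Lemma sum_discr_hat_coprime d q M N D : (0 < d)%N -> odd q ->
  (forall n, 0 < n <= q ^ 2 -> size (divisors n) <= D)%N ->
  \sum_(b < q | coprime b q) `|discr_hat (d * q) M N (d * b)| ^+ 2
    <= (9 * 1944 * D ^ 5 * q * (M ^ 2 + N ^ 2))%:R.
Proof.
move=> d_gt0 oq tauD; have q_gt0 : (0 < q)%N by case: (q) oq.
have q_pos : 0 < q%:R :> C by rewrite ltr0n.
have D_gt0 : (0 < D)%N by apply: (tauD 1%N); rewrite expn_gt0 q_gt0.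
pose B := (1944 * D ^ 5)%N.
have part m n :
  ((n%:R / q%:R) ^+ 2 + 1) * (\sum_(b < q | coprime b q) `|gauss_err q b (m %% q)| ^+ 4)
    <= (B * q * (m ^ 2 + n ^ 2))%:R.
  have le_m : (m %% q <= q)%N by rewrite ltnW ?ltn_mod.
  have := sum_pow4_gauss_err oq le_m tauD; rewrite -/B => le4.
  have c_ge0 : 0 <= (n%:R / q%:R) ^+ 2 + 1 :> C by rewrite addr_ge0 ?exprn_ge0 ?divr_ge0 ?ler0n.
  apply: le_trans (ler_wpM2l c_ge0 le4) _.
  rewrite mulnDr natrD addrC mulrDl mul1r; apply: lerD.
    by rewrite ler_nat leq_mul2l leq_sqr leq_mod orbT.
  rewrite expr_div_n mulrAC ler_pdivrMr ?exprn_gt0 // -!natrX -!natrM ler_nat.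
  rewrite mulnC [leqRHS]mulnAC leq_mul2r; apply/orP; right.
  by rewrite leq_mul2l leq_sqr le_m orbT.
apply: (@le_trans _ _ (\sum_(b < q | coprime b q)
   3 * (M%:R ^+ 2 + N%:R ^+ 2 + ((N%:R / q%:R) ^+ 2 + 1) * `|gauss_err q b (M %% q)| ^+ 4
         + ((M%:R / q%:R) ^+ 2 + 1) * `|gauss_err q b (N %% q)| ^+ 4))).
  by apply: ler_sum => b cb; apply: sqnorm_discr_hat_le.
rewrite -mulr_sumr 2!big_split /= -!mulr_sumr.
have le0 : \sum_(b < q | coprime b q) (M%:R ^+ 2 + N%:R ^+ 2) <= (q * (M ^ 2 + N ^ 2))%:R :> C.
  rewrite sumr_const -[X in X <= _]mulr_natl -!natrX -natrD -natrM ler_nat leq_mul2r.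
  by apply/orP; right; rewrite -[leqRHS](card_ord q) max_card.
apply: (@le_trans _ _ (3 * (q * (M ^ 2 + N ^ 2) + B * q * (M ^ 2 + N ^ 2)
   + B * q * (N ^ 2 + M ^ 2))%:R)).
  rewrite ler_wpM2l ?ler0n // natrD [(_ + B * q * _)%:R]natrD.
  by apply: lerD (part N M); apply: lerD (part M N).
rewrite -natrM ler_nat /B.
have le5 : (q * (M ^ 2 + N ^ 2) <= D ^ 5 * (q * (M ^ 2 + N ^ 2)))%N.
  by rewrite leq_pmull // expn_gt0 D_gt0.
move: le5; rewrite [(N ^ 2 + _)%N]addnC -!(mulnA _ q).
move: (q * _)%N (D ^ 5)%N => c f; rewrite -!mulnA; move: (f * c)%N => g. lia.
Qed.

(** Every frequency [a] modulo [q] reduces to a primitive frequency modulo exactly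
    one divisor [q / d] of [q]. *)
Lemma sum_discr_hat q M N D : odd q ->
  (forall n, 0 < n <= q ^ 2 -> size (divisors n) <= D)%N ->
  \sum_(a < q) `|discr_hat q M N a| ^+ 2 <= (9 * 1944 * D ^ 6 * q * (M ^ 2 + N ^ 2))%:R.
Proof.
move=> oq tauD; have q_gt0 : (0 < q)%N by case: (q) oq.
have -> : \sum_(a < q) `|discr_hat q M N a| ^+ 2
   = \sum_(d <- divisors q) \sum_(a < q | gcdn a q == d) `|discr_hat q M N a| ^+ 2.
  rewrite (exchange_big_dep xpredT) //=; apply: eq_bigr => a _.
  rewrite (big_rem (gcdn a q)) /=; last by rewrite -dvdn_divisors ?dvdn_gcdr.
  rewrite eqxx big_seq_cond big1 ?addr0 // => d.
  by rewrite mem_rem_uniq ?divisors_uniq // inE /= => /andP[/andP[/negPf ne _]]; rewrite eq_sym ne.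
apply: (@le_trans _ _ (\sum_(d <- divisors q) (9 * 1944 * D ^ 5 * q * (M ^ 2 + N ^ 2))%:R)).
  rewrite big_seq [leRHS]big_seq; apply: ler_sum => d; rewrite -dvdn_divisors // => dq.
  have d_gt0 := dvdn_gt0 q_gt0 dq; have qE : (d * (q %/ d) = q)%N by rewrite mulnC divnK.
  have q'_gt0 : (0 < q %/ d)%N by rewrite divn_gt0 // dvdn_leq.
  have le_q' : (q %/ d <= q)%N by rewrite leq_div.
  have := sum_gcd_class (fun a => `|discr_hat q M N a| ^+ 2) d_gt0 q'_gt0.
  rewrite qE => ->; apply: (@le_trans _ _ (9 * 1944 * D ^ 5 * (q %/ d) * (M ^ 2 + N ^ 2))%:R).
    have := @sum_discr_hat_coprime d (q %/ d) M N D d_gt0; rewrite qE; apply.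
      by move: oq; rewrite -{1}qE oddM => /andP[].
    move=> n /andP[n_gt0 le_n]; apply: tauD; rewrite n_gt0 (leq_trans le_n) //.
    by rewrite leq_sqr.
  by rewrite ler_nat leq_mul2r leq_mul2l le_q' !orbT.
rewrite big_const_seq count_predT iter_addr_0 -mulrnA ler_nat.
have le_t : (size (divisors q) <= D)%N by apply: tauD; rewrite q_gt0 -mulnn leq_pmull.
apply: leq_trans (leq_mul (leqnn _) le_t) _.
by apply: eq_leq; rewrite !expnS; ring.
Qed.

Lemma parseval q (x : nat -> C) : (0 < q)%N ->
  \sum_(a < q) `|\sum_(1 <= c < q.+1) x c * expi q (a%:Z * c%:Z)| ^+ 2
    = q%:R * \sum_(1 <= c < q.+1) `|x c| ^+ 2.
Proof.
move=> q_gt0.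
transitivity (\sum_(1 <= c < q.+1) \sum_(1 <= c' < q.+1) x c * (x c')^*%R *
    \sum_(a < q) expi q ((c%:Z - c'%:Z) * a%:Z)).
  under eq_bigr do rewrite normCK rmorph_sum mulr_suml.
  rewrite exchange_big /=; apply: eq_bigr => c _.
  under eq_bigr do rewrite mulr_sumr.
  rewrite exchange_big /=; apply: eq_bigr => c' _.
  rewrite mulr_sumr; apply: eq_bigr => a _.
  by rewrite rmorphM /= -expiN mulrACA -expiD; congr (_ * expi _ _); ring.
rewrite mulr_sumr; apply: eq_big_nat => c /andP[c_gt0 lt_c].
rewrite (bigD1_seq c) ?iota_uniq ?mem_index_iota ?c_gt0 //=.
rewrite sum_expi // subrr dvdz0 -normCK mulrC big_seq_cond big1 ?addr0 // => c'.
rewrite mem_index_iota => /andP[/andP[c'_gt0 lt_c'] ne].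
rewrite sum_expi //; case: ifP => [|_]; last by rewrite mulr0.
rewrite dvdzE absz_nat => dv; case/negP: ne; apply/eqP; apply/esym.
exact: eq_of_dvd_dist lt_c lt_c' c_gt0 c'_gt0 dv.
Qed.

Lemma sum_residue q (z : int) : (0 < q)%N ->
  (\sum_(1 <= c < q.+1) (z == c%:Z %[mod q])%Z = 1)%N.
Proof.
move=> q_gt0; pose c0 := `|((z - 1) %% q)%Z|%N.
have r_ge0 : 0 <= ((z - 1) %% q)%Z by rewrite modz_ge0 // -lt0n.
have r_lt : ((z - 1) %% q)%Z < q%:Z by rewrite ltz_pmod.
have c0E : c0%:Z = ((z - 1) %% q)%Z by rewrite /c0 gez0_abs.
have lt_c0 : (c0 < q)%N by rewrite -ltz_nat c0E.
have zc0 : (z == c0.+1%:Z %[mod q])%Z.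
  by rewrite intS c0E modzDmr addrC subrK.
rewrite (bigD1_seq c0.+1) ?iota_uniq ?mem_index_iota //= zc0.
rewrite big_seq_cond big1 ?addn0 // => c.
rewrite mem_index_iota => /andP[/andP[c_gt0 lt_c] ne]; apply/eqP; rewrite eqb0.
apply: contra ne => /eqP zc; apply/eqP.
have : (c%:Z == c0.+1%:Z %[mod q])%Z by rewrite -zc.
rewrite eqz_mod_dvd dvdzE absz_nat => dv.
exact: eq_of_dvd_dist lt_c (lt_c0 : (c0.+1 < q.+1)%N) c_gt0 _ dv.
Qed.

Lemma gauss_ordE q a M :
  gauss q a M = \sum_(m < M.+1 | (0 < m)%N) expi q (a%:Z * m%:Z ^+ 2).
Proof. by rewrite big_mkcond big_ord_recl /= add0r /gauss big_mkord. Qed.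

Lemma sum_count_e q M N a : (0 < q)%N ->
  \sum_(1 <= c < q.+1) (A M N q c%:Z)%:R * expi q (a%:Z * c%:Z)
    = gauss q a M * (gauss q a N)^*%R.
Proof.
move=> q_gt0; pose P (p : 'I_M.+1 * 'I_N.+1) := (0 < p.1)%N && (0 < p.2)%N.
pose z (p : 'I_M.+1 * 'I_N.+1) : int := p.1%:Z ^+ 2 - p.2%:Z ^+ 2.
transitivity (\sum_(p | P p) \sum_(1 <= c < q.+1)
    (z p == c%:Z %[mod q])%Z%:R * expi q (a%:Z * c%:Z)).
  rewrite exchange_big /=; apply: eq_bigr => c _.
  rewrite -mulr_suml -natr_sum; congr (_%:R * _).
  rewrite /A -sum1dep_card big_mkcondr /=.
  rewrite [LHS]big_mkcond [RHS]big_mkcond; apply: eq_bigr => p _.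
  by rewrite /P /z; case: (0 < p.1)%N => //=; case: (0 < p.2)%N => //=; case: eqP.
transitivity (\sum_(p | P p) expi q (a%:Z * z p)).
  apply: eq_bigr => p _.
  rewrite (eq_bigr (fun c => (z p == c%:Z %[mod q])%Z%:R * expi q (a%:Z * z p))) => [|c _].
    by rewrite -mulr_suml -natr_sum sum_residue // mul1r.
  case: eqP => [zc|_]; last by rewrite !mul0r.
  congr (_ * _); apply: expi_mod => //; rewrite -mulrBr dvdz_mull // -eqz_mod_dvd.
  by rewrite zc.
rewrite !gauss_ordE rmorph_sum mulr_suml.
rewrite -(pair_big_dep (fun m : 'I_M.+1 => 0 < m)%N (fun _ (n : 'I_N.+1) => 0 < n)%N
  (fun m n => expi q (a%:Z * z (m, n)))) /=.
apply: eq_bigr => m _; rewrite mulr_sumr; apply: eq_bigr => n _.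
by rewrite /= -expiN -expiD /z mulrBr.
Qed.

(** Parseval turns the second moment of the discrepancy into that of its Fourier
    transform. *)
Lemma sum_sqr_Delta q M N D : odd q ->
  (forall n, 0 < n <= q ^ 2 -> size (divisors n) <= D)%N ->
  \sum_(1 <= c < q.+1) Delta R M N q c%:Z ^+ 2
    <= (9 * 1944 * D ^ 6 * (M ^ 2 + N ^ 2))%:R.
Proof.
move=> oq tauD; have q_gt0 : (0 < q)%N by case: (q) oq.
pose y c : R := (A M N q c%:Z)%:R - (M%:R * N%:R) / q%:R ^+ 2 * (A0 q c%:Z)%:R.
have yE c : `|(y c)%:C| ^+ 2 = (Delta R M N q c%:Z ^+ 2)%:C.
  by rewrite -add_Re2_Im2 /= expr0n addr0 /Delta real_normK // num_real.
rewrite -lecR rmorph_sum rmorph_nat /=.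
under eq_bigr do rewrite -yE.
have q_pos : 0 < q%:R :> C by rewrite ltr0n.
rewrite -(ler_pM2l q_pos) -parseval // -natrM.
apply: le_trans (_ : (9 * 1944 * D ^ 6 * q * (M ^ 2 + N ^ 2))%:R <= _); last first.
  by rewrite ler_nat mulnCA mulnA.
rewrite [leLHS](_ : _ = \sum_(a < q) `|discr_hat q M N a| ^+ 2); first exact: sum_discr_hat.
apply: eq_bigr => a _; congr (`|_| ^+ 2).
under eq_bigr => c _.
  rewrite /y rmorphB rmorphM fmorph_div rmorphM rmorphXn !rmorph_nat mulrBl -(mulrA _ _ (expi _ _)).
over.
rewrite sumrB -mulr_sumr /A0 !sum_count_e // /discr_hat -normCK.
by [].
Qed.
End ExponentialSums.

(** * The mean square discrepancy *)

Theorem theorem1 (R : realType) :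
  forall eps : R, 0 < eps ->
  exists C : R, 0 < C /\
    forall q M N : nat,
      odd q -> (0 < M <= q)%N -> (0 < N <= q)%N ->
      \sum_(1 <= c < q.+1) Delta R M N q c%:Z ^+ 2
        <= C * (M%:R + N%:R) ^+ 2 * q%:R `^ eps.
Proof.
move=> eps eps_gt0.
(* The sixth power of [D] is at most [q ^ eps] up to a constant as soon as
   [D ^ (6 * k)] is at most a constant times [q ^ 2] with [2 <= eps * k]. *)
have [k k_gt0 le_k] : exists2 k : nat, (0 < k)%N & 2 <= eps * k%:R.
  exists (Num.truncn (2 / eps)).+1 => //.
  by rewrite mulrC -ler_pdivrMr //; apply/ltW/truncnS_gt.
have [K K_gt0 tauK] := @size_divisors_exp (6 * k) (leq_mul (isT : 0 < 6)%N k_gt0).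
exists ((9 * 1944)%:R * K%:R); split; first by rewrite mulr_gt0 ?ltr0n.
move=> q M N oq _ _; have q_gt0 : (0 < q)%N by case: (q) oq.
pose D := (\max_(n < (q ^ 2).+1 | (0 < n)%N) size (divisors n))%N.
have leD n : (0 < n <= q ^ 2)%N -> (size (divisors n) <= D)%N.
  move=> /andP[n_gt0 le_n].
  by have := @leq_bigmax_cond _ (fun n : 'I_(q ^ 2).+1 => 0 < n)%N (fun n => size (divisors n))
    (Ordinal (le_n : (n < (q ^ 2).+1)%N)) n_gt0.
have D6 : ((D ^ 6) ^ k <= K * q ^ 2)%N.
  rewrite -expnM /D; elim/big_ind: _ => [|x y hx hy|n n_gt0].
  - by rewrite exp0n // muln_gt0.
  - by rewrite /maxn; case: ifP.
  by apply: leq_trans (tauK _ n_gt0) _; rewrite leq_mul2l -ltnS ltn_ord orbT.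
have D6R : (D ^ 6)%:R <= K%:R * q%:R `^ eps :> R.
  have q1 : 1 <= q%:R :> R by rewrite ler1n.
  rewrite -(@ler_pXn2r _ k) ?nnegrE ?ler0n ?mulr_ge0 ?powR_ge0 //.
  rewrite exprMn -(powR_mulrn k (powR_ge0 _ _)) -powRrM -natrX.
  apply: (@le_trans _ _ (K * q ^ 2)%:R); first by rewrite ler_nat.
  rewrite natrM ler_pM ?ler0n //.
    by rewrite -natrX ler_nat -{1}[K]expn1 leq_pexp2l.
  by rewrite natrX -powR_mulrn ?ler0n // ler_powR.
apply: le_trans (sum_sqr_Delta R M N oq leD) _.
rewrite natrM mulrAC natrM -!mulrA ler_wpM2l ?ler0n //.
rewrite mulrA ler_pM ?ler0n //.
by rewrite -natrD -natrX ler_nat sqrnD leq_addr.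
Qed.
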